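(* Let $(M_\Phi,M_\Psi)$ be the pair of isometries on $H^2(\mathcal{E})$ associated to a BCL triple $(\mathcal{E},U,P)$. Then $M_\Phi$ is a pure isometry if and only if $PU^*P|_{\operatorname{ran}P}$ is a pure contraction on $\operatorname{ran} P$, and $M_\Psi$ is a pure isometry if and only if $P^\perp U P^\perp|_{\operatorname{ran}P^\perp}$ is a pure contraction on $\operatorname{ran}P^\perp$.
   Context: All Hilbert spaces are complex. A contraction $T$ on a Hilbert space $\mathcal{H}$ is pure if $\|T^{*m}h\|\to0$ as $m\to\infty$ for every $h\in\mathcal{H}$; a pure isometry is an isometry that is a pure contraction. For a Hilbert space $\mathcal{E}$, $H^2(\mathcal{E})$ is the Hardy space of $\mathcal{E}$-valued analytic functions $f(z)=\sum_{k\ge0}\eta_k z^k$ on the unit disc $\mathbb{D}$ with $\|f\|^2=\sum_k\|\eta_k\|^2<\infty$; for a bounded analytic $\mathcal{B}(\mathcal{E})$-valued function $\Theta$ on $\mathbb{D}$, $M_\Theta$ denotes multiplication by $\Theta$ on $H^2(\mathcal{E})$. A BCL triple $(\mathcal{E},U,P)$ consists of a Hilbert space $\mathcal{E}$, a unitary $U$ on $\mathcal{E}$ and an orthogonal projection $P$ on $\mathcal{E}$; $P^\perp=I_{\mathcal{E}}-P$. The pair $(M_\Phi,M_\Psi)$ associated to it is given by $\Phi(z)=(P+zP^\perp)U^*$ and $\Psi(z)=U(P^\perp+zP)$, $z\in\mathbb{D}$; these are commuting isometries with $M_\Phi M_\Psi=M_z$. *)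

(* Defs.v *)
From HB Require Import structures.
From mathcomp Require Import all_boot all_order all_algebra.
From mathcomp Require Import sesquilinear.
From mathcomp Require Import boolp classical_sets functions reals.
From mathcomp Require Import interval_inference topology normedtype sequences.
From mathcomp Require Import complex.
From mathcomp Require Import ring lra.
Set Implicit Arguments.
Unset Strict Implicit.
Unset Printing Implicit Defensive.
Import Order.TTheory GRing.Theory Num.Theory.
Import numFieldNormedType.Exports.
Local Open Scope classical_set_scope.
Local Open Scope complex_scope.
Local Open Scope ring_scope.

HB.instance Definition _ (R : realType) := NormedModule.copy R[i] R[i]^o.

(* The norm of a normed module over R[i] takes its values in R[i]; [rnorm] is
   the same number seen in R. *)
Section RealNorm.
Variables (R : realType) (V : normedZmodType R[i]).
Implicit Types x y : V.

Definition rnorm x : R := complex.Re `|x|.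

Lemma rnormE x : `|x| = (rnorm x)%:C.
Proof. by rewrite /rnorm RRe_real// ger0_real. Qed.

Lemma rnorm_ge0 x : 0 <= rnorm x.
Proof. by rewrite -ler0c -rnormE. Qed.

Lemma rnormD x y : rnorm (x + y) <= rnorm x + rnorm y.
Proof. by rewrite -lecR rmorphD /= -!rnormE ler_normD. Qed.

Lemma rnorm0 : rnorm 0 = 0.
Proof. by rewrite /rnorm normr0. Qed.

Lemma rnorm0_eq0 x : rnorm x = 0 -> x = 0.
Proof. by move=> h; apply/normr0_eq0; rewrite rnormE h. Qed.

Lemma rnormN x : rnorm (- x) = rnorm x.
Proof. by rewrite /rnorm normrN. Qed.

Lemma rnormBC x y : rnorm (x - y) = rnorm (y - x).
Proof. by rewrite /rnorm distrC. Qed.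

Lemma rnorm_sum n (u : nat -> V) m :
  rnorm (\sum_(m <= k < n) u k) <= \sum_(m <= k < n) rnorm (u k).
Proof.
rewrite -lecR rmorph_sum /= -rnormE.
by under [leRHS]eq_bigr do rewrite -rnormE; exact: ler_norm_sum.
Qed.

End RealNorm.

Lemma rnormZ (R : realType) (V : normedModType R[i]) (a : R[i]) (x : V) :
  rnorm (a *: x) = rnorm a * rnorm x.
Proof. by apply/complexI; rewrite rmorphM /= -!rnormE normrZ. Qed.

Lemma rnormC (R : realType) (a : R) : rnorm (a%:C : R[i]) = `|a|.
Proof. by rewrite /rnorm normc_def /= expr0n addr0 sqrtr_sqr. Qed.

Lemma normi (R : realType) : `|'i : R[i]| = 1.
Proof. by rewrite normc_def /= expr0n /= expr1n add0r sqrtr1. Qed.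

Lemma small_sequence (R : realType) : exists2 d : nat -> R,
  (forall n, 0 < d n) &
  forall e, 0 < e -> exists N, forall n, (N <= n)%N -> d n < e.
Proof.
exists (fun n => n.+1%:R^-1) => [n|e e0]; first by rewrite invr_gt0.
exists (Num.truncn e^-1) => n Nn.
rewrite -[ltRHS]invrK ltf_pV2 ?posrE ?invr_gt0//.
by apply: lt_le_trans (truncnS_gt _) _; rewrite ler_nat ltnS.
Qed.

Section Cauchy.
Variables (R : realType) (V : normedModType R[i]).

Definition cauchy_seq (u : nat -> V) := forall e : R, 0 < e ->
  exists N, forall m n, (N <= m)%N -> (N <= n)%N -> rnorm (u m - u n) < e.

Definition cvg_seq (u : nat -> V) l := forall e : R, 0 < e ->
  exists N, forall n, (N <= n)%N -> rnorm (l - u n) < e.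

Lemma posC (e : R[i]) : 0 < e -> e = (complex.Re e)%:C /\ 0 < complex.Re e.
Proof.
by move=> e0; rewrite -ltcR RRe_real ?gtr0_real.
Qed.

Lemma cvg_seqP (u : nat -> V) l : u @ \oo --> l <-> cvg_seq u l.
Proof.
split.
  move=> /cvgrPdist_lt h e e0.
  have /h[N _ hN] : 0 < e%:C by rewrite ltcR.
  by exists N => n Nn; have := hN _ Nn; rewrite /= rnormE ltcR.
move=> h; apply/cvgrPdist_lt => e /posC[-> /h[N hN]].
by exists N => // n /= /hN; rewrite rnormE ltcR.
Qed.

Lemma cvg_cauchy_seq (u : nat -> V) l : cvg_seq u l -> cauchy_seq u.
Proof.
move=> h e e0; have /h[N hN] : 0 < e / 2 by rewrite divr_gt0.
exists N => m n Nm Nn; rewrite -(subrKA l) -opprB.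
have := hN _ Nm; have := hN _ Nn; have := rnormD (- (l - u m)) (l - u n).
rewrite rnormN; lra.
Qed.

Lemma cauchy_seq_cauchy (u : nat -> V) : cauchy_seq u -> cauchy (u @ \oo).
Proof.
move=> h; apply: cauchy_exP => e /posC[-> /h[N hN]].
by exists (u N); exists N => // n /= Nn; rewrite -ball_normE /= rnormE ltcR hN.
Qed.

Lemma seq_complete : (forall u, cauchy_seq u -> exists l, cvg_seq u l) ->
  forall F : set_system V, ProperFilter F -> cauchy F -> cvg F.
Proof.
move=> h F FF /cauchyP Fc.
have [d d0 small] := small_sequence R.
have /choice[x xF] : forall n : nat, exists x, F (ball x (d n)%:C).
  by move=> n; apply: Fc; rewrite ltcR.
have xc : cauchy_seq x.
  move=> e e0; have /small[N hN] : 0 < e / 2 by rewrite divr_gt0.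
  exists N => m n Nm Nn.
  have [y []] := filter_ex (filterI (xF m) (xF n)).
  rewrite -!ball_normE /= !rnormE !ltcR => ym yn.
  rewrite -(subrKA y) -[y - _]opprB.
  have := rnormD (x m - y) (- (x n - y)); rewrite rnormN.
  have := hN _ Nm; have := hN _ Nn. lra.
have [l xl] := h _ xc; apply/cvg_ex; exists l.
apply/cvgrPdist_lt => e /posC[-> e0].
have e20 : 0 < complex.Re e / 2 by rewrite divr_gt0.
have [N1 h1] := small _ e20; have [N2 h2] := xl _ e20.
pose n := maxn N1 N2.
near=> y; rewrite rnormE ltcR.
have : ball (x n) (d n)%:C y by near: y; exact: xF.
rewrite -ball_normE /= rnormE ltcR => xy.
rewrite -(subrKA (x n)).
have := rnormD (l - x n) (x n - y).
have := h1 _ (leq_maxl N1 N2); have := h2 _ (leq_maxr N1 N2); rewrite -/n; lra.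
Unshelve. all: by end_near. Qed.

Lemma cvg_seq_unique (u : nat -> V) l l' : cvg_seq u l -> cvg_seq u l' -> l = l'.
Proof. by move=> /cvg_seqP h /cvg_seqP; apply: cvg_unique h. Qed.

End Cauchy.

Lemma complex_complete (R : realType) (F : set_system R[i]) :
  ProperFilter F -> cauchy F -> cvg F.
Proof.
move: F; apply: seq_complete => u uc.
have rc (f : R[i] -> R) : (forall x y, `|f x - f y| <= rnorm (x - y)) ->
    exists l, forall e, 0 < e -> exists N, forall n, (N <= n)%N -> `|l - f (u n)| < e.
  move=> fle; have : cauchy ((f \o u) @ \oo).
    apply: cauchy_exP => e /uc[N hN]; exists (f (u N)); exists N => // n /= Nn.
    by rewrite -ball_normE /=; apply: le_lt_trans (fle _ _) _; exact: hN.
  move=> /cauchy_cvgP/cvg_ex[l /cvgrPdist_lt ul]; exists l => e /ul[N _ hN].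
  by exists N => n /hN.
have [x xP] : exists l, forall e, 0 < e ->
    exists N, forall n, (N <= n)%N -> `|l - complex.Re (u n)| < e.
  apply: rc => x y; rewrite -raddfB -lecR -rnormE; exact: normc_ge_Re.
have [y yP] : exists l, forall e, 0 < e ->
    exists N, forall n, (N <= n)%N -> `|l - complex.Im (u n)| < e.
  apply: rc => x' y; rewrite -raddfB -lecR -rnormE -normrN -ReiNIm.
  apply: le_trans (normc_ge_Re _) _.
  by rewrite normrM normi mulr1.
exists (x +i* y) => e e0.
have e20 : 0 < e / 2 by rewrite divr_gt0.
have [N1 h1] := xP _ e20; have [N2 h2] := yP _ e20.
exists (maxn N1 N2) => n; rewrite geq_max => /andP[/h1 xn /h2 yn].
suff : rnorm (x +i* y - u n) <= `|x - complex.Re (u n)| + `|y - complex.Im (u n)| by lra.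
have -> : x +i* y - u n = (x - complex.Re (u n))%:C + 'i * (y - complex.Im (u n))%:C.
  by case: (u n) => a b /=; simpc.
apply: le_trans (rnormD _ _) _; rewrite rnormC lerD2l.
rewrite le_eqVlt; apply/orP; left; apply/eqP/complexI.
by rewrite -rnormE normrM normi mul1r rnormE rnormC.
Qed.

HB.instance Definition _ (R : realType) :=
  Uniform_isComplete.Build R[i] (@complex_complete R).

Section CauchySchwarz.
Variables (C : numClosedFieldType) (V : lmodType C) (dot : {dot V for Num.conj}).

Lemma dot_CauchySchwarz (x y : V) :
  `|dot x y| <= sqrtC (dot x x) * sqrtC (dot y y).
Proof.
rewrite -[leLHS]sqrCK// -sqrtCM ?nnegrE// ler_sqrtC ?nnegrE ?exprn_ge0 ?mulr_ge0//.
have [->|y0] := eqVneq y 0.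
  by rewrite !linear0r mulr0 normr0 expr0n.
have yy0 : 0 < dot y y by rewrite dnorm_gt0.
pose a := dot x y / dot y y.
have : 0 <= dot (x - a *: y) (x - a *: y) by [].
have o : dot (x - a *: y) y = 0.
  by rewrite linearBl/= linearZl_LR /= divfK ?subrr// gt_eqF.
rewrite [X in _ <= X -> _]linearBr /= [dot _ (a *: y)]linearZr_LR /= o mulr0 subr0.
rewrite linearBl /= linearZl_LR /= subr_ge0 /a mulrAC ler_pdivrMr//.
by rewrite normCK [(dot x y)^*]( _ : _ = dot y x)// [RHS]hermC /= expr0 mul1r.
Qed.

Lemma dot_triangle (x y : V) :
  sqrtC (dot (x + y) (x + y)) <= sqrtC (dot x x) + sqrtC (dot y y).
Proof.
rewrite -ler_sqr ?nnegrE ?addr_ge0 ?sqrtC_ge0// sqrrD !sqrtCK dnormD [leRHS]addrAC lerD2l.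
rewrite -[_ + _^*](@divfK _ 2)// -ReE -[leRHS]mulr_natr ler_wpM2r ?ler0n//.
apply: le_trans (dot_CauchySchwarz _ _); exact: (leif_Re_Creal _).1.
Qed.

End CauchySchwarz.

(* The library's sesquilinear forms are linear in the first argument and
   conjugate-linear in the second. *)
HB.mixin Record CompleteNormedModule_isHilbert (R : realType) V
    & CompleteNormedModule R[i] V := {
  inner : {dot V for Num.conj} ;
  normr_inner : forall x : V, `|x| ^+ 2 = inner x x
}.

#[short(type="hilbertType")]
HB.structure Definition Hilbert (R : realType) :=
  {V of CompleteNormedModule R[i] V & CompleteNormedModule_isHilbert R V}.

(* Builds the norm and its topology from the inner product; [inner_complete]
   is the convergence of Cauchy sequences, written with squared distances. *)
HB.factory Record Lmodule_isHilbert (R : realType) V & GRing.Lmodule R[i] V := {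
  inner : V -> V -> R[i] ;
  innerDZl : forall a x y z, inner (a *: x + y) z = a * inner x z + inner y z ;
  innerJ : forall x y, inner x y = (inner y x)^* ;
  inner_gt0 : forall x, x != 0 -> 0 < inner x x ;
  inner_complete : forall u : nat -> V,
    (forall e : R, 0 < e -> exists N, forall m n, (N <= m)%N -> (N <= n)%N ->
      inner (u m - u n) (u m - u n) < e%:C) ->
    exists l, forall e : R, 0 < e -> exists N, forall n, (N <= n)%N ->
      inner (l - u n) (l - u n) < e%:C
}.

HB.builders Context R V & Lmodule_isHilbert R V.

Fact inner_bilinear : bilinear_for
  (GRing.Scale.Law.clone _ _ *%R _) (GRing.Scale.Law.clone _ _ (Num.conj \; *%R) _)
  inner.
Proof.
split=> [z a x y /=|x a y z /=]; first exact: innerDZl.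
by rewrite innerJ innerDZl rmorphD rmorphM /= -!innerJ.
Qed.

HB.instance Definition _ := @bilinear_isBilinear.Build _ _ _ _ _ _ _ inner_bilinear.

Fact inner_herm (x y : V) : inner x y = (-1) ^+ false * (inner y x)^*.
Proof. by rewrite mul1r innerJ. Qed.

HB.instance Definition _ := @isHermitianSesquilinear.Build _ _ _ _ _ inner_herm.
HB.instance Definition _ := @isDotProduct.Build _ _ inner inner_gt0.

Let dot : {dot V for Num.conj} := inner.

Let norm (x : V) := sqrtC (inner x x).

Fact normZ (a : R[i]) x : norm (a *: x) = `|a| * norm x.
Proof.
rewrite /norm (dnormZ dot a x) sqrtCM ?nnegrE ?exprn_ge0 ?(dnorm_ge0 dot)//.
by rewrite sqrCK.
Qed.

Fact norm_eq0 x : norm x = 0 -> x = 0.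
Proof. by move=> /eqP; rewrite (sqrt_dnorm_eq0 dot) => /eqP. Qed.

HB.instance Definition _ := @Lmodule_isNormed.Build R[i] V norm
  (dot_triangle dot) normZ norm_eq0.

Fact norm_inner (x : V) : `|x| ^+ 2 = dot x x.
Proof. by rewrite [`|x|]/(norm x) sqrtCK. Qed.

Fact inner_lt (x : V) (e : R) : 0 < e -> (inner x x < (e ^+ 2)%:C) = (rnorm x < e).
Proof.
move=> e0; rewrite -[inner x x]norm_inner rnormE -rmorphXn /= ltcR.
by rewrite ltr_pXn2r// nnegrE ?rnorm_ge0// ltW.
Qed.

Fact complete (F : set_system V) : ProperFilter F -> cauchy F -> cvg F.
Proof.
move: F; apply: seq_complete => u uc; have [e e0|l lP] := @inner_complete u.
  have /uc[N hN] : 0 < Num.sqrt e by rewrite sqrtr_gt0.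
  exists N => m n Nm Nn.
  by rewrite -[e]sqr_sqrtr ?ltW// inner_lt ?sqrtr_gt0// hN.
exists l => e e0; have /lP[N hN] : 0 < e ^+ 2 by rewrite exprn_gt0.
by exists N => n /hN; rewrite inner_lt.
Qed.

HB.instance Definition _ := Uniform_isComplete.Build V complete.
HB.instance Definition _ := CompleteNormedModule_isHilbert.Build R V norm_inner.

HB.end.

Section HilbertTheory.
Variables (R : realType) (E : hilbertType R).
Implicit Types x y z : E.

Lemma innerDl x y z : inner (x + y) z = inner x z + inner y z.
Proof. by rewrite linearDl. Qed.
Lemma innerDr x y z : inner x (y + z) = inner x y + inner x z.
Proof. by rewrite linearDr. Qed.
Lemma innerBl x y z : inner (x - y) z = inner x z - inner y z.
Proof. by rewrite linearBl. Qed.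
Lemma innerBr x y z : inner x (y - z) = inner x y - inner x z.
Proof. by rewrite linearBr. Qed.
Lemma innerZl a x y : inner (a *: x) y = a * inner x y.
Proof. by rewrite linearZl_LR. Qed.
Lemma innerZr a x y : inner x (a *: y) = Num.conj a * inner x y.
Proof. by rewrite linearZr_LR. Qed.
Lemma innerC x y : inner x y = Num.conj (inner y x).
Proof. by rewrite hermC expr0 mul1r. Qed.
Lemma inner0l x : inner 0 x = 0.
Proof. by rewrite linear0l. Qed.

Lemma inner_rnorm x : inner x x = (rnorm x ^+ 2)%:C.
Proof. by rewrite -normr_inner rnormE rmorphXn. Qed.

Lemma inner_lt_rnorm x (e : R) :
  0 < e -> (inner x x < (e ^+ 2)%:C) = (rnorm x < e).
Proof.
by move=> e0; rewrite inner_rnorm ltcR ltr_pXn2r// nnegrE ?rnorm_ge0// ltW.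
Qed.

Lemma inner_norm_le x y : rnorm (inner x y) <= rnorm x * rnorm y.
Proof.
have := dot_CauchySchwarz inner x y.
by rewrite -!normr_inner !sqrCK// !rnormE -rmorphM lecR.
Qed.

Lemma inner_inj x y : (forall z, inner z x = inner z y) -> x = y.
Proof.
move=> h; apply/eqP; rewrite -subr_eq0 -(dnorm_eq0 inner) [inner _ _]linearBr.
by rewrite /= h subrr.
Qed.

End HilbertTheory.

Section Operators.
Variables (R : realType) (E F : hilbertType R).
Implicit Types T : E -> F.

Definition bounded_operator T :=
  linear T /\ exists M : R[i], forall x, `|T x| <= M * `|x|.

Definition isometry_operator T := linear T /\ forall x, `|T x| = `|x|.

Definition contraction T := linear T /\ forall x, `|T x| <= `|x|.

Definition is_adjoint T (S : F -> E) := forall x y, inner (T x) y = inner x (S y).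

(* By [adjointP] below, the default value is irrelevant for bounded operators. *)
Definition adjoint T : F -> E := xget (fun=> 0) [set S | is_adjoint T S].

Lemma adjoint_eq T S : is_adjoint T S -> adjoint T = S.
Proof.
move=> TS; apply: xget_unique => // S' TS'; apply/funext => y.
by apply: inner_inj => x; rewrite -TS' TS.
Qed.

End Operators.

Definition unitary (R : realType) (E : hilbertType R) (U : E -> E) :=
  [/\ bounded_operator U, adjoint U \o U = id & U \o adjoint U = id].

Definition pure_contraction (R : realType) (E : hilbertType R) (T : E -> E) :=
  contraction T /\
  forall h, (fun m => `|iter m (adjoint T) h|) @ \oo --> (0 : R[i]).

Definition pure_isometry (R : realType) (E : hilbertType R) (T : E -> E) :=
  isometry_operator T /\ pure_contraction T.

Lemma bounded_operatorP (R : realType) (E F : hilbertType R) (T : E -> F) :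
  bounded_operator T <->
  linear T /\ exists2 M : R, 0 <= M & forall x, rnorm (T x) <= M * rnorm x.
Proof.
split=> -[Tl [M]].
  move=> TM; split => //; exists (rnorm M); first exact: rnorm_ge0.
  move=> x; rewrite -lecR rmorphM /= -!rnormE; apply: le_trans (TM x) _.
  have [->|x0] := eqVneq x 0; first by rewrite normr0 !mulr0.
  rewrite ler_wpM2r// real_ler_norm// realE.
  have : 0 <= M * `|x| by apply: le_trans (TM x).
  by rewrite pmulr_lge0 ?normr_gt0// => ->.
by move=> M0 TM; split => //; exists M%:C => x; rewrite !rnormE -rmorphM lecR.
Qed.

Section Riesz.
Variables (R : realType) (E : hilbertType R) (phi : E -> R[i]).
Hypothesis phi_linear : forall a x y, phi (a *: x + y) = a * phi x + phi y.
Variable M : R.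
Hypothesis phi_bounded : forall x, rnorm (phi x) <= M * rnorm x.

Let phi0 : phi 0 = 0.
Proof.
have := phi_linear 1 0 0; rewrite scale1r addr0 mul1r => /eqP.
by rewrite -subr_eq0 opprD addNKr oppr_eq0 => /eqP.
Qed.

Let phiZ a x : phi (a *: x) = a * phi x.
Proof. by rewrite -[a *: x]addr0 phi_linear phi0 addr0. Qed.

Let phiD x y : phi (x + y) = phi x + phi y.
Proof. by rewrite -[x]scale1r phi_linear mul1r scale1r. Qed.

Let phiB x y : phi (x - y) = phi x - phi y.
Proof. by rewrite phiD -scaleN1r phiZ mulN1r. Qed.

Let parallelogram (x y : E) :
  rnorm (x + y) ^+ 2 + rnorm (x - y) ^+ 2 = 2 * (rnorm x ^+ 2 + rnorm y ^+ 2).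
Proof.
apply: complexI; rewrite mulr_natl rmorphMn !rmorphD /= -!inner_rnorm.
by rewrite !(innerBl, innerBr, innerDl, innerDr); ring.
Qed.

Lemma Riesz : exists y, forall x, phi x = inner x y.
Proof.
have [phi0'|] := pselect (forall x, phi x = 0).
  by exists 0 => x; rewrite phi0' innerC inner0l rmorph0.
move=> /existsNP[x0 /eqP px0].
pose A := [set r | exists2 x, phi x = 1 & r = rnorm x].
have A1 : A !=set0.
  by exists (rnorm ((phi x0)^-1 *: x0)); eexists; last by []; rewrite phiZ mulVf.
have Alb : lbound A 0 by move=> _ [x _ ->]; exact: rnorm_ge0.
have Ainf : has_inf A by split => //; exists 0.
pose d := inf A.
have d0 : 0 <= d by apply: lb_le_inf.
have dle x : phi x = 1 -> d <= rnorm x.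
  by move=> px; apply: ge_inf; [exists 0|exists x].
have [s s0 small] := small_sequence R.
have /choice[u uP] : forall n, exists x, phi x = 1 /\ rnorm x ^+ 2 < d ^+ 2 + s n.
  move=> n; pose e := Num.sqrt (d ^+ 2 + s n) - d.
  have dd : 0 <= d ^+ 2 + s n by rewrite addr_ge0 ?sqr_ge0// ltW.
  have e0 : 0 < e.
    rewrite subr_gt0 -{1}[d]ger0_norm// -sqrtr_sqr ltr_sqrt ?ltrDl//.
    by rewrite ltr_wpDl ?sqr_ge0.
  have [_ [x px ->] xe] := inf_adherent e0 Ainf; exists x; split => //.
  rewrite -[ltRHS]sqr_sqrtr// ltr_pXn2r ?nnegrE ?rnorm_ge0 ?sqrtr_ge0//.
  by move: xe; rewrite /e -/d; lra.
have d2 x : phi x = 1 -> d ^+ 2 <= rnorm x ^+ 2.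
  by move=> /dle dx; rewrite ler_pXn2r// nnegrE rnorm_ge0.
have uc : cauchy_seq u.
  move=> e e0; have /small[N hN] : 0 < e ^+ 2 / 4 by rewrite divr_gt0 ?exprn_gt0.
  exists N => m n Nm Nn; have [pm um] := uP m; have [pn un] := uP n.
  rewrite -(@ltr_pXn2r _ 2) ?nnegrE ?rnorm_ge0 ?ltW//.
  have p := parallelogram (u m) (u n).
  have : d ^+ 2 <= rnorm (2^-1 *: (u m + u n)) ^+ 2.
    by apply: d2; rewrite phiZ phiD pm pn; field.
  have -> : rnorm (2^-1 *: (u m + u n)) ^+ 2 = rnorm (u m + u n) ^+ 2 / 4.
    rewrite rnormZ exprMn mulrC; congr (_ * _).
    have -> : (2^-1 : R[i]) = (2^-1 : R)%:C by rewrite fmorphV rmorph_nat.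
    by rewrite rnormC ger0_norm ?invr_ge0//; field.
  by move: (hN _ Nm) (hN _ Nn) => ? ?; lra.
have [y uy] : exists y, cvg_seq u y.
  exists (lim (u @ \oo)); apply/cvg_seqP.
  exact: (cauchy_cvg (u @ \oo) (cauchy_seq_cauchy uc)).
have M0 : 0 <= M.
  have := phi_bounded x0; have := rnorm_ge0 (phi x0); have := rnorm_ge0 x0.
  have x0n : rnorm x0 != 0.
    by apply: contra_neq px0 => /rnorm0_eq0 ->; exact: phi0.
  move=> h1 h2 h3; have {}h1 : 0 < rnorm x0 by rewrite lt_def x0n.
  by rewrite -(pmulr_lge0 _ h1); apply: le_trans h3.
have py : phi y = 1.
  apply/eqP; rewrite -subr_eq0; apply/eqP/rnorm0_eq0/eqP.
  rewrite eq_le rnorm_ge0 andbT; apply/ler_addgt0Pl => e e0; rewrite addr0.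
  have M1 : 0 < M + 1 by lra.
  have /uy[N hN] : 0 < e / (M + 1) by rewrite divr_gt0.
  have [pN _] := uP N; rewrite -pN -phiB.
  apply: le_trans (phi_bounded _) _.
  have := hN _ (leqnn N); rewrite ltr_pdivlMr// => h.
  have := rnorm_ge0 (y - u N); nra.
have yd : rnorm y = d.
  apply/eqP; rewrite eq_le dle// andbT; apply/ler_addgt0Pl => e e0.
  have e20 : 0 < e / 2 by rewrite divr_gt0.
  have [N1 h1] := uy _ e20.
  have [N2 h2] := small (e ^+ 2 / 4) ltac:(rewrite divr_gt0 ?exprn_gt0//).
  pose n := maxn N1 N2.
  have := h1 n (leq_maxl _ _); have := h2 n (leq_maxr _ _) => sn yn.
  have [_ un] := uP n.
  have un' : rnorm (u n) < d + e / 2.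
    rewrite -(@ltr_pXn2r _ 2) ?nnegrE ?rnorm_ge0 ?addr_ge0 ?(ltW e20)//.
    by nra.
  have := rnormD (y - u n) (u n); rewrite subrK; lra.
have orth v : phi v = 0 -> inner v y = 0.
  move=> pv; have [->|v0] := eqVneq v 0; first exact: inner0l.
  have vv : 0 < inner v v by rewrite dnorm_gt0.
  pose a := inner y v / inner v v.
  have h : d ^+ 2 <= rnorm (y - a *: v) ^+ 2.
    by apply: d2; rewrite phiB phiZ pv mulr0 subr0.
  have : inner y y <= inner (y - a *: v) (y - a *: v).
    by rewrite !inner_rnorm yd lecR.
  have o : inner (y - a *: v) v = 0 by rewrite innerBl innerZl divfK ?subrr// gt_eqF.
  rewrite [X in _ <= X -> _]innerBr innerZr o mulr0 subr0 innerBl innerZl.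
  rewrite -subr_ge0 addrC addKr oppr_ge0 /a mulrAC pmulr_lle0 ?invr_gt0//.
  rewrite [inner v y]innerC -normCK => h'.
  have : `|inner y v| ^+ 2 = 0 by apply/eqP; rewrite eq_le h' exprn_ge0.
  by move=> /eqP; rewrite expf_eq0 normr_eq0 => /eqP ->; rewrite rmorph0.
have yy : inner y y != 0.
  by rewrite dnorm_eq0; apply: contra_eq_neq py => ->; rewrite phi0 eq_sym oner_eq0.
exists ((Num.conj (inner y y))^-1 *: y) => x.
have /orth : phi (x - phi x *: y) = 0 by rewrite phiB phiZ py mulr1 subrr.
rewrite innerBl innerZl => /eqP; rewrite subr_eq0 => /eqP e.
rewrite innerZr rmorphV ?unitfE ?conjC_eq0//=.
by rewrite conjCK e mulrC mulfK.
Qed.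

End Riesz.

Lemma adjointP (R : realType) (E F : hilbertType R) (T : E -> F) :
  bounded_operator T -> is_adjoint T (adjoint T).
Proof.
move=> /bounded_operatorP[Tl [M M0 TM]].
suff [S TS] : exists S, is_adjoint T S by rewrite (adjoint_eq TS).
suff /choice[S SP] : forall y, exists z, forall x, inner (T x) y = inner x z.
  by exists S => x y; exact: SP.
move=> y; apply: (@Riesz _ _ _ _ (M * rnorm y)) => [a u v|x].
  by rewrite Tl innerDl innerZl.
apply: le_trans (inner_norm_le _ _) _; rewrite mulrAC ler_wpM2r ?rnorm_ge0//.
Qed.

Lemma bounded_comp (R : realType) (E F G : hilbertType R)
    (S : F -> G) (T : E -> F) :
  bounded_operator S -> bounded_operator T -> bounded_operator (S \o T).
Proof.
move=> /bounded_operatorP[Sl [M M0 SM]] /bounded_operatorP[Tl [N N0 TN]].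
apply/bounded_operatorP; split=> [a x y /=|]; first by rewrite Tl Sl.
exists (M * N) => [|x /=]; first exact: mulr_ge0.
by apply: le_trans (SM _) _; rewrite -mulrA ler_wpM2l.
Qed.

Lemma bounded_adjoint (R : realType) (E F : hilbertType R) (T : E -> F) :
  bounded_operator T -> bounded_operator (adjoint T).
Proof.
move=> Tb; have TP := adjointP Tb.
have /bounded_operatorP[Tl [M M0 TM]] := Tb.
apply/bounded_operatorP; split.
  move=> a x y; apply: inner_inj => z.
  by rewrite -TP !innerDr !innerZr !TP.
exists M => // y; have [y0|y0] := eqVneq (rnorm (adjoint T y)) 0.
  by rewrite y0 mulr_ge0// rnorm_ge0.
have {}y0 : 0 < rnorm (adjoint T y) by rewrite lt_def y0 rnorm_ge0.
have : rnorm (adjoint T y) ^+ 2 <= rnorm (T (adjoint T y)) * rnorm y.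
  apply: le_trans (inner_norm_le _ _).
  by rewrite TP inner_rnorm rnormC ger0_norm// sqr_ge0.
have := ler_wpM2r (rnorm_ge0 y) (TM (adjoint T y)).
move=> h1 h2; have := le_trans h2 h1.
by rewrite mulrAC expr2 ler_pM2r.
Qed.

Section OrthogonalProjections.
Variables (R : realType) (E : hilbertType R).

Record orthoproj := OrthoProj {
  orthoproj_fun :> E -> E ;
  orthoproj_bounded : bounded_operator orthoproj_fun ;
  orthoproj_idem : forall x, orthoproj_fun (orthoproj_fun x) = orthoproj_fun x ;
  orthoproj_adjoint : adjoint orthoproj_fun = orthoproj_fun
}.

Variable P : orthoproj.

Fact perp_bounded : bounded_operator (fun x => x - P x).
Proof.
have /bounded_operatorP[Pl [M M0 PM]] := orthoproj_bounded P.
apply/bounded_operatorP; split=> [a x y|].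
  by rewrite Pl scalerBr opprD addrACA.
exists (1 + M) => [|x]; first by rewrite addr_ge0.
by apply: le_trans (rnormD _ _) _; rewrite rnormN mulrDl mul1r lerD2l.
Qed.

Fact perp_idem x : x - P x - P (x - P x) = x - P x.
Proof.
have [Pl _] := orthoproj_bounded P.
have -> : P (x - P x) = 0.
  by rewrite addrC -scaleN1r Pl orthoproj_idem scaleN1r addNr.
by rewrite subr0.
Qed.

Fact perp_adjoint : adjoint (fun x => x - P x) = (fun x => x - P x).
Proof.
apply: adjoint_eq => x y; rewrite innerBl innerBr (adjointP (orthoproj_bounded P)).
by rewrite orthoproj_adjoint.
Qed.

Definition perp : orthoproj := OrthoProj perp_bounded perp_idem perp_adjoint.

Record ran := Ran { ran_val :> E ; ran_valP : ran_val \in range P }.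

HB.instance Definition _ := [isSub for ran_val].
HB.instance Definition _ := [Choice of ran by <:].

Lemma in_ranP x : reflect (P x = x) (x \in range P).
Proof.
apply: (iffP idP) => [|<-]; last by rewrite inE; exists x.
by rewrite inE => -[y _ <-]; exact: orthoproj_idem.
Qed.

Fact ran_submod_closed : submod_closed (fun x => x \in range P).
Proof.
have [Pl _] := orthoproj_bounded P.
split=> [|a x y]; rewrite !inE/=.
  by exists 0 => //; have := Pl (-1) 0 0; rewrite scaler0 addr0 scaleN1r addNr.
by move=> [x' _ <-] [y' _ <-]; exists (a *: x' + y') => //; rewrite Pl.
Qed.

HB.instance Definition _ := GRing.SubChoice_isSubLmodule.Build R[i] E _ ran
  (GRing.submod_closed_semi ran_submod_closed).

Let ran_inner (x y : ran) : R[i] := inner (x : E) (y : E).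

Fact ran_innerDZl a x y z : ran_inner (a *: x + y) z = a * ran_inner x z + ran_inner y z.
Proof. by rewrite /ran_inner innerDl innerZl. Qed.

Fact ran_innerJ x y : ran_inner x y = Num.conj (ran_inner y x).
Proof. exact: innerC. Qed.

Fact ran_inner_gt0 x : x != 0 -> 0 < ran_inner x x.
Proof. by move=> x0; rewrite dnorm_gt0; apply: contra_neq x0 => h; exact: val_inj. Qed.

Fact ran_complete (u : nat -> ran) :
  (forall e : R, 0 < e -> exists N, forall m n, (N <= m)%N -> (N <= n)%N ->
     ran_inner (u m - u n) (u m - u n) < e%:C) ->
  exists l, forall e : R, 0 < e -> exists N, forall n, (N <= n)%N ->
     ran_inner (l - u n) (l - u n) < e%:C.
Proof.
move=> uc; pose v n : E := u n.
have vc : cauchy_seq v.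
  move=> e e0; have /uc[N hN] : 0 < e ^+ 2 by rewrite exprn_gt0.
  by exists N => m n Nm Nn; rewrite -inner_lt_rnorm//; exact: hN.
have [l vl] : exists l, cvg_seq v l.
  exists (lim (v @ \oo)); apply/cvg_seqP.
  exact: (cauchy_cvg (v @ \oo) (cauchy_seq_cauchy vc)).
have lP : l \in range P.
  have /bounded_operatorP[Pl [M M0 PM]] := orthoproj_bounded P.
  apply/in_ranP/(@cvg_seq_unique _ _ v) => // e e0.
  have M1 : 0 < M + 1 by lra.
  have /vl[N hN] : 0 < e / (M + 1) by rewrite divr_gt0.
  exists N => n /hN; rewrite ltr_pdivlMr// => h.
  have -> : v n = P (v n) by apply/esym/in_ranP; exact: valP (u n).
  have -> : P l - P (v n) = P (l - v n).
    by rewrite addrC -scaleN1r -Pl scaleN1r addrC.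
  apply: le_lt_trans (PM _) _; have := rnorm_ge0 (l - v n); nra.
exists (Ran lP) => e e0.
have /vl[N hN] : 0 < Num.sqrt e by rewrite sqrtr_gt0.
exists N => n Nn; rewrite -[e]sqr_sqrtr ?ltW//.
by rewrite /ran_inner inner_lt_rnorm ?sqrtr_gt0//; exact: hN.
Qed.

HB.instance Definition _ := Lmodule_isHilbert.Build R ran
  ran_innerDZl ran_innerJ ran_inner_gt0 ran_complete.

Lemma perpE x : perp x = x - P x.
Proof. by []. Qed.

Lemma ran_innerE (x y : ran) : inner x y = inner (x : E) (y : E).
Proof. by []. Qed.

Fact proj_in_ran x : P x \in range P.
Proof. by rewrite inE; exists x. Qed.

Definition compression (T : E -> E) (x : ran) : ran := Ran (proj_in_ran (T (P x))).

End OrthogonalProjections.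

Arguments compression {R E} P T x.

Section AbsoluteConvergence.
Variables (R : realType) (V : completeNormedModType R[i]).

Lemma real_sum_cvg (a : nat -> R) M : (forall k, 0 <= a k) ->
  (forall n, \sum_(0 <= k < n) a k <= M) -> cvgn (series a).
Proof.
move=> a0 aM; apply: nondecreasing_is_cvgn.
  by apply/nondecreasing_seqP => n; rewrite seriesSr lerDl.
by exists M => _ [n _ <-]; exact: aM.
Qed.

Lemma abs_cvg (u : nat -> V) M :
  (forall n, \sum_(0 <= k < n) rnorm (u k) <= M) -> cvgn (series u).
Proof.
move=> uM; apply/cauchy_cvgP/cauchy_seq_cauchy.
have /cvg_ex[l /cvgrPdist_lt al] :=
  real_sum_cvg (fun k => rnorm_ge0 (u k)) uM.
move=> e e0; have /al[N _ hN] : 0 < e / 2 by rewrite divr_gt0.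
have H : forall m n, (N <= m)%N -> (m <= n)%N -> rnorm (series u m - series u n) < e.
  move=> m n Nm mn; rewrite rnormBC sub_series_geq//.
  apply: le_lt_trans (rnorm_sum _ _ _) _.
  rewrite -sub_series_geq//.
  have /= := hN _ Nm; have /= := hN _ (leq_trans Nm mn).
  rewrite !ltr_norml => /andP[h1 h2] /andP[h3 h4]; lra.
exists N => m n Nm Nn; have [mn|/ltnW mn] := leqP m n; first exact: H.
by rewrite rnormBC; exact: H.
Qed.

End AbsoluteConvergence.

Section HardySpace.
Variables (R : realType) (E : hilbertType R).
Implicit Types (eta xi : nat -> E).

Definition disc := {z : R[i] | `|z| < 1}.

Definition square_summable eta := cvgn (series (fun k => `|eta k| ^+ 2 : R[i])).

Definition has_expansion (f : disc -> E) eta :=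
  forall z : disc, series (fun k => val z ^+ k *: eta k) @ \oo --> f z.

Definition in_hardy (f : disc -> E) :=
  exists2 eta, square_summable eta & has_expansion f eta.

Lemma square_summableP eta : square_summable eta <->
  exists M, forall n, \sum_(0 <= k < n) rnorm (eta k) ^+ 2 <= M.
Proof.
have sE n : series (fun k => `|eta k| ^+ 2 : R[i]) n =
    (\sum_(0 <= k < n) rnorm (eta k) ^+ 2)%:C.
  rewrite rmorph_sum /series /=; apply: eq_bigr => k _.
  by rewrite rnormE -rmorphXn.
split.
  move=> /cvg_ex[l /cvg_seqP/(_ 1 ltr01)[N hN]].
  exists (rnorm l + 1) => n; apply: (@le_trans _ _ (\sum_(0 <= k < maxn N n) rnorm (eta k) ^+ 2)).
    rewrite (big_cat_nat (leq0n n) (leq_maxr N n)) /= lerDl sumr_ge0// => k _.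
    exact: sqr_ge0.
  have := hN _ (leq_maxl N n); rewrite sE => h.
  have := rnormD ((\sum_(0 <= k < maxn N n) rnorm (eta k) ^+ 2)%:C - l) l.
  rewrite subrK rnormBC rnormC; have := ler_norm (\sum_(0 <= k < maxn N n) rnorm (eta k) ^+ 2); lra.
move=> [M hM]; apply: (@abs_cvg _ _ _ M) => n; apply: le_trans (hM n).
apply: ler_sum => k _; by rewrite rnormE -rmorphXn rnormC ger0_norm// sqr_ge0.
Qed.

Lemma square_summable_le eta xi c : 0 <= c -> square_summable xi ->
  (forall k, rnorm (eta k) <= c * rnorm (xi k)) -> square_summable eta.
Proof.
move=> c0 /square_summableP[M hM] h; apply/square_summableP.
exists (c ^+ 2 * M) => n; apply: le_trans (ler_wpM2l (sqr_ge0 c) (hM n)).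
rewrite mulr_sumr; apply: ler_sum => k _.
by rewrite -exprMn ler_pXn2r// nnegrE ?rnorm_ge0// mulr_ge0// rnorm_ge0.
Qed.

Lemma square_summableD eta xi : square_summable eta -> square_summable xi ->
  square_summable (fun k => eta k + xi k).
Proof.
move=> /square_summableP[M hM] /square_summableP[N hN]; apply/square_summableP.
exists (2 * M + 2 * N) => n.
apply: (@le_trans _ _ (2 * \sum_(0 <= k < n) rnorm (eta k) ^+ 2 +
                       2 * \sum_(0 <= k < n) rnorm (xi k) ^+ 2)); last first.
  by rewrite lerD// ler_wpM2l.
rewrite !mulr_sumr -big_split; apply: ler_sum => k _ /=.
have := rnormD (eta k) (xi k); have := rnorm_ge0 (eta k + xi k).
have := sqr_ge0 (rnorm (eta k) - rnorm (xi k)); nra.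
Qed.

Lemma square_summableZ a eta : square_summable eta ->
  square_summable (fun k => a *: eta k).
Proof.
by move=> h; apply: (square_summable_le (rnorm_ge0 a) h) => k; rewrite rnormZ.
Qed.

Lemma square_summable0 : square_summable (fun=> 0).
Proof.
apply/square_summableP; exists 0 => n.
by rewrite big1// => k _; rewrite rnorm0 expr0n.
Qed.

Lemma square_summable_bounded eta : square_summable eta ->
  exists2 B, 0 <= B & forall k, rnorm (eta k) <= B.
Proof.
move=> /square_summableP[M hM]; exists (M + 1).
  by have := hM 0%N; rewrite big_geq//; lra.
move=> k; have := hM k.+1; rewrite big_nat_recr//=.
have : 0 <= \sum_(0 <= i < k) rnorm (eta i) ^+ 2.
  by apply: sumr_ge0 => i _; exact: sqr_ge0.
have := sqr_ge0 (rnorm (eta k) - 1); have := sqr_ge0 (rnorm (eta k)); nra.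
Qed.

Lemma geometric_le (t : R) n : 0 <= t -> t < 1 ->
  \sum_(0 <= k < n) t ^+ k <= (1 - t)^-1.
Proof.
move=> t0 t1; have ? : 0 < 1 - t by rewrite subr_gt0.
rewrite -[leRHS]mul1r ler_pdivlMr// mulrC big_mkord.
have := subrX1 t n; rewrite -[t - 1]opprB mulNr => /(congr1 -%R); rewrite opprK => <-.
by rewrite opprB lerBlDr lerDl exprn_ge0.
Qed.

Lemma rnormX (z : R[i]) k : rnorm (z ^+ k) = rnorm z ^+ k.
Proof. by apply: complexI; rewrite rmorphXn /= -!rnormE normrX. Qed.

Lemma disc_rnorm (z : disc) : rnorm (val z) < 1.
Proof. by rewrite -ltcR -rnormE; exact: (valP z). Qed.

Lemma square_summable_cvg eta : square_summable eta ->
  forall z : disc, cvgn (series (fun k => val z ^+ k *: eta k)).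
Proof.
move=> /square_summable_bounded[B B0 hB] z.
apply: (@abs_cvg _ _ _ ((1 - rnorm (val z))^-1 * B)) => n.
apply: le_trans (ler_wpM2r B0 (geometric_le n (rnorm_ge0 _) (disc_rnorm z))).
rewrite mulr_suml; apply: ler_sum => k _.
by rewrite rnormZ rnormX ler_wpM2l// exprn_ge0// rnorm_ge0.
Qed.

Lemma in_hardy_series eta : square_summable eta ->
  in_hardy (fun z => lim (series (fun k => val z ^+ k *: eta k) @ \oo)).
Proof. by move=> h; exists eta => // z; exact: square_summable_cvg. Qed.

Lemma has_expansionDZ f g eta xi a : has_expansion f eta -> has_expansion g xi ->
  has_expansion (fun z => a *: f z + g z) (fun k => a *: eta k + xi k).
Proof.
move=> hf hg z.
rewrite (_ : series _ = (fun n => a *: series (fun k => val z ^+ k *: eta k) n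
    + series (fun k => val z ^+ k *: xi k) n)).
  by apply: cvgD; [apply: cvgZl_tmp; exact: hf | exact: hg].
apply/funext => n; rewrite /series /= scaler_sumr -big_split; apply: eq_bigr => k _.
by rewrite /= scalerDr !scalerA mulrC.
Qed.

Lemma has_expansion0_eq0 eta : square_summable eta ->
  has_expansion (fun=> 0) eta -> eta = fun=> 0.
Proof.
move=> /square_summable_bounded[B B0 hB] h; apply/funext => n.
elim/ltn_ind: n => n IH.
suff H (t : R) : 0 < t -> t <= 2^-1 -> rnorm (eta n) <= 2 * B * t.
  apply/rnorm0_eq0/eqP; rewrite eq_le rnorm_ge0 andbT leNgt; apply/negP => e0.
  pose t := Num.min 2^-1 (rnorm (eta n) / (4 * B + 1)).
  have B1 : 0 < 4 * B + 1 by lra.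
  have t0 : 0 < t by rewrite lt_min invr_gt0 ltr0n /= divr_gt0.
  have := H t t0; rewrite ge_min lexx => /(_ isT).
  have : t <= rnorm (eta n) / (4 * B + 1) by rewrite ge_min lexx orbT.
  rewrite ler_pdivlMr//; nra.
move=> t0 t2; rewrite -subr_le0; apply/ler_addgt0Pl => e e0; rewrite addr0.
have tn0 : 0 < t ^+ n by rewrite exprn_gt0.
have td : `|t%:C : R[i]| < 1 by rewrite rnormE rnormC ltcR ger0_norm ?ltW//; lra.
pose z : disc := exist _ t%:C td.
have /cvg_seqP/(_ (t ^+ n * e)) := h z.
rewrite mulr_gt0// => /(_ isT)[N hN].
have {hN} := hN (n.+1 + N)%N (leq_addl _ _).
rewrite sub0r rnormN /series /= (big_cat_nat (leq0n n.+1) (leq_addr _ _)) /=.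
rewrite big_nat_recr//= big_nat_cond big1 ?add0r; last first.
  by move=> k /andP[/andP[_ /IH -> _]]; rewrite scaler0.
set T := \sum_(n.+1 <= k < _) _ => hT.
have Tle : rnorm T <= t ^+ n * (2 * B * t).
  apply: le_trans (rnorm_sum _ _ _) _.
  rewrite -{1}[n.+1]add0n big_addn addKn.
  apply: (@le_trans _ _ (\sum_(0 <= k < N) t ^+ k * (t ^+ n.+1 * B))).
    apply: ler_sum => k _; rewrite rnormZ rnormX rnormC ger0_norm; last exact: ltW.
    by rewrite exprD -mulrA !ler_wpM2l// exprn_ge0// ltW.
  rewrite -mulr_suml.
  have g : \sum_(0 <= k < N) t ^+ k <= 2.
    apply: le_trans (geometric_le N (ltW t0) _) _; first by lra.
    by rewrite -[leRHS]invrK lef_pV2 ?posrE ?invr_gt0//; lra.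
  apply: le_trans (ler_wpM2r _ g) _; first by rewrite mulr_ge0// exprn_ge0// ltW.
  by rewrite exprS; lra.
have : t ^+ n * rnorm (eta n) <= t ^+ n * e + t ^+ n * (2 * B * t).
  have -> : t ^+ n * rnorm (eta n) = rnorm (t%:C ^+ n *: eta n).
    by rewrite rnormZ rnormX rnormC ger0_norm ?ltW.
  have := rnormD (t%:C ^+ n *: eta n + T) (- T).
  rewrite addrK rnormN; lra.
by rewrite -mulrDr ler_pM2l// lerBlDr.
Qed.

Lemma has_expansion_unique f eta xi : square_summable eta -> square_summable xi ->
  has_expansion f eta -> has_expansion f xi -> eta = xi.
Proof.
move=> eta2 xi2 feta fxi.
have h2 := square_summableD (@square_summableZ (-1) _ xi2) eta2.
have h0 := @has_expansionDZ _ _ _ _ (-1) fxi feta.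
have := has_expansion0_eq0 h2 => h; apply/funext => k.
have fE : (fun z => -1 *: f z + f z) = (fun=> 0).
  by apply/funext => z; rewrite scaleN1r addNr.
move: h0; rewrite fE => /h/(congr1 (@^~ k)).
by rewrite scaleN1r addrC => /eqP; rewrite subr_eq0 => /eqP.
Qed.

(* Elements of H^2(E) are functions on the disc; the sequence of coefficients is
   recovered by [taylor], and is unique by [has_expansion_unique]. *)
Record hardy := Hardy { hardy_fun :> disc -> E ; hardyP : `[< in_hardy hardy_fun >] }.

HB.instance Definition _ := [isSub for hardy_fun].
HB.instance Definition _ := [Choice of hardy by <:].

Fact hardy_submod_closed :
  submod_closed (fun f : disc -> E => `[< in_hardy f >]).
Proof.
split=> [|a f g]; rewrite -!topredE /=.
  apply/asboolP; exists (fun=> 0); first exact: square_summable0.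
  move=> z; rewrite (_ : series _ = fun=> 0); first exact: cvg_cst.
  by apply/funext => n; rewrite /series /= big1// => k _; rewrite scaler0.
move=> /asboolP[eta eta2 feta] /asboolP[xi xi2 gxi]; apply/asboolP.
exists (fun k => a *: eta k + xi k); last exact: (@has_expansionDZ _ _ _ _ a feta gxi).
exact: (square_summableD (@square_summableZ a _ eta2) xi2).
Qed.

HB.instance Definition _ := GRing.SubChoice_isSubLmodule.Build R[i] (disc -> E) _ hardy
  (GRing.submod_closed_semi hardy_submod_closed).

Definition taylor (f : hardy) : nat -> E :=
  xget (fun=> 0) [set eta | square_summable eta /\ has_expansion f eta].

Lemma taylorP f : square_summable (taylor f) /\ has_expansion f (taylor f).
Proof.
have /asboolP[eta eta2 feta] := hardyP f.
exact: (@xgetPex _ _ [set eta | square_summable eta /\ has_expansion f eta]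
  (ex_intro _ eta (conj eta2 feta))).
Qed.

Lemma taylor_eq (f : hardy) eta :
  square_summable eta -> has_expansion f eta -> taylor f = eta.
Proof. by have [h1 h2] := taylorP f => ? ?; apply: (@has_expansion_unique f). Qed.

Lemma taylorDZ a f g : taylor (a *: f + g) = (fun k => a *: taylor f k + taylor g k).
Proof.
have [f1 f2] := taylorP f; have [g1 g2] := taylorP g; apply: taylor_eq.
  exact: (square_summableD (@square_summableZ a _ f1) g1).
exact: (@has_expansionDZ _ _ _ _ a f2 g2).
Qed.

Lemma taylorB f g : taylor (f - g) = (fun k => taylor f k - taylor g k).
Proof.
rewrite addrC -scaleN1r taylorDZ; apply/funext => k.
by rewrite scaleN1r addrC.
Qed.

Definition hardy_inner (f g : hardy) : R[i] :=
  lim (series (fun k => inner (taylor f k) (taylor g k)) @ \oo).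

Lemma hardy_inner_cvg f g : cvgn (series (fun k => inner (taylor f k) (taylor g k))).
Proof.
have [/square_summableP[M hM] _] := taylorP f.
have [/square_summableP[N hN] _] := taylorP g.
apply: (@abs_cvg _ _ _ (M + N)) => n.
apply: le_trans (lerD (hM n) (hN n)).
rewrite -big_split; apply: ler_sum => k _ /=.
apply: le_trans (inner_norm_le _ _) _.
have := sqr_ge0 (rnorm (taylor f k) - rnorm (taylor g k)).
have := rnorm_ge0 (taylor f k); have := rnorm_ge0 (taylor g k); nra.
Qed.

Fact hardy_innerDZl a f g h :
  hardy_inner (a *: f + g) h = a * hardy_inner f h + hardy_inner g h.
Proof.
apply: cvg_lim => //.
rewrite (_ : series _ =
    (fun n => a *: series (fun k => inner (taylor f k) (taylor h k)) n
            + series (fun k => inner (taylor g k) (taylor h k)) n)).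
  by apply: cvgD; [apply: cvgZl_tmp; exact: hardy_inner_cvg|exact: hardy_inner_cvg].
apply/funext => n; rewrite /series /= scaler_sumr -big_split; apply: eq_bigr => k _.
by rewrite taylorDZ innerDl innerZl.
Qed.

Fact hardy_innerJ f g : hardy_inner f g = Num.conj (hardy_inner g f).
Proof.
apply: cvg_lim => //; apply/cvg_seqP => e e0.
have /cvg_seqP/(_ e e0)[N hN] := @hardy_inner_cvg g f.
exists N => n /hN.
have -> : series (fun k => inner (taylor f k) (taylor g k)) n =
    Num.conj (series (fun k => inner (taylor g k) (taylor f k)) n).
  by rewrite /series /= rmorph_sum; apply: eq_bigr => k _; exact: innerC.
by rewrite -rmorphB /rnorm norm_conjC.
Qed.

Lemma hardy_innerE f : exists r, [/\ hardy_inner f f = r%:C,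
  (forall n, \sum_(0 <= k < n) rnorm (taylor f k) ^+ 2 <= r) &
  (forall B, (forall n, \sum_(0 <= k < n) rnorm (taylor f k) ^+ 2 <= B) -> r <= B)].
Proof.
have [/square_summableP[M hM] _] := taylorP f.
have s0 k : 0 <= rnorm (taylor f k) ^+ 2 by exact: sqr_ge0.
have sc := real_sum_cvg s0 hM.
have nd : nondecreasing_seq (series (fun k => rnorm (taylor f k) ^+ 2)).
  by apply/nondecreasing_seqP => n; rewrite seriesSr lerDl.
exists (lim (series (fun k => rnorm (taylor f k) ^+ 2) @ \oo)); split.
- apply: cvg_lim => //; apply/cvg_seqP => e e0.
  have /cvgrPdist_lt/(_ e e0)[N _ hN] := sc.
  exists N => n /hN /=.
  rewrite (_ : series (fun k => inner _ _) n =
    (series (fun k => rnorm (taylor f k) ^+ 2) n)%:C).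
    by rewrite -rmorphB rnormC.
  by rewrite /series /= rmorph_sum; apply: eq_bigr => k _; rewrite inner_rnorm.
- exact: nondecreasing_cvgn_le.
- by move=> B hB; apply: limr_le => //; apply: nearW.
Qed.

Fact hardy_inner_gt0 f : f != 0 -> 0 < hardy_inner f f.
Proof.
have [r [-> hr _]] := hardy_innerE f => f0.
have r0 : 0 <= r by have := hr 0%N; rewrite big_geq.
rewrite ltcR lt_def r0 andbT; apply: contra_neq f0 => r00.
apply: val_inj; apply/funext => z /=.
have [_ /(_ z)] := taylorP f.
rewrite (_ : series _ = fun=> 0).
  by move=> h; apply: (cvg_unique _ h) => //; exact: cvg_cst.
apply/funext => n; rewrite /series /= big1// => k _.
suff -> : taylor f k = 0 by rewrite scaler0.
apply/rnorm0_eq0/eqP; rewrite -sqrf_eq0 eq_le sqr_ge0 andbT -r00.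
apply: le_trans (hr k.+1); rewrite big_nat_recr//= lerDr sumr_ge0// => i _.
exact: sqr_ge0.
Qed.

Fact hardy_complete (u : nat -> hardy) :
  (forall e : R, 0 < e -> exists N, forall m n, (N <= m)%N -> (N <= n)%N ->
     hardy_inner (u m - u n) (u m - u n) < e%:C) ->
  exists l, forall e : R, 0 < e -> exists N, forall n, (N <= n)%N ->
     hardy_inner (l - u n) (l - u n) < e%:C.
Proof.
move=> uc; pose c n := taylor (u n).
have cc e : 0 < e -> exists N, forall m n, (N <= m)%N -> (N <= n)%N ->
    forall K, \sum_(0 <= k < K) rnorm (c m k - c n k) ^+ 2 <= e.
  move=> e0; have [N hN] := uc _ e0; exists N => m n Nm Nn K.
  have := hN _ _ Nm Nn; have [r [-> hr _]] := hardy_innerE (u m - u n).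
  rewrite ltcR => re; apply/ltW/(le_lt_trans _ re).
  by have := hr K; rewrite taylorB.
have /choice[eta etaP] : forall k, exists l, cvg_seq (c ^~ k) l.
  move=> k; exists (lim ((c ^~ k) @ \oo)); apply/cvg_seqP.
  apply: (cauchy_cvg ((c ^~ k) @ \oo)); apply: cauchy_seq_cauchy => e e0.
  have /cc[N hN] : 0 < (e / 2) ^+ 2 by rewrite exprn_gt0// divr_gt0.
  exists N => m n Nm Nn; apply: (@le_lt_trans _ _ (e / 2)); last by lra.
  rewrite -(@ler_pXn2r _ 2) ?nnegrE ?rnorm_ge0 ?divr_ge0 ?(ltW e0)//.
  apply: le_trans (hN _ _ Nm Nn k.+1).
  by rewrite big_nat_recr//= lerDr sumr_ge0// => i _; exact: sqr_ge0.
have fin K e : 0 < e -> exists N, forall m, (N <= m)%N ->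
    \sum_(0 <= k < K) rnorm (eta k - c m k) ^+ 2 <= e.
  elim: K e => [|K IH] e e0; first by exists 0%N => m _; rewrite big_geq ?ltW.
  have e20 : 0 < e / 2 by rewrite divr_gt0.
  have [N1 h1] := IH _ e20.
  have [|N2 h2] := etaP K (Num.sqrt (e / 2)); first by rewrite sqrtr_gt0.
  exists (maxn N1 N2) => m; rewrite geq_max => /andP[/h1 m1 /h2 m2].
  rewrite big_nat_recr//= [e in _ <= e](splitr e) lerD//.
  rewrite -[e / 2]sqr_sqrtr ?(ltW e20)// ler_pXn2r ?nnegrE ?rnorm_ge0 ?sqrtr_ge0//.
  exact: ltW.
have tail e : 0 < e -> exists N, forall n, (N <= n)%N ->
    forall K, \sum_(0 <= k < K) rnorm (eta k - c n k) ^+ 2 <= e.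
  move=> e0; have e40 : 0 < e / 4 by rewrite divr_gt0.
  have [N hN] := cc _ e40; exists N => n Nn K.
  have [N' hN'] := fin K _ e40.
  pose m := maxn N N'.
  have h1 := hN _ _ (leq_maxl N N') Nn K; have h2 := hN' _ (leq_maxr N N').
  rewrite -/m in h1 h2.
  apply: (@le_trans _ _ (2 * \sum_(0 <= k < K) rnorm (eta k - c m k) ^+ 2 +
                         2 * \sum_(0 <= k < K) rnorm (c m k - c n k) ^+ 2)).
    rewrite !mulr_sumr -big_split; apply: ler_sum => k _ /=.
    have := rnormD (eta k - c m k) (c m k - c n k); rewrite subrKA.
    have := rnorm_ge0 (eta k - c n k).
    have := sqr_ge0 (rnorm (eta k - c m k) - rnorm (c m k - c n k)); nra.
  lra.
have eta2 : square_summable eta.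
  have [N hN] := tail 1 ltr01.
  have d2 : square_summable (fun k => eta k - c N k).
    by apply/square_summableP; exists 1; exact: hN.
  have := square_summableD d2 (taylorP (u N)).1; congr square_summable.
  by apply/funext => k; rewrite subrK.
pose l := Hardy (asboolT (in_hardy_series eta2)).
have tl : taylor l = eta by apply: taylor_eq => // z; exact: square_summable_cvg.
exists l => e e0; have /tail[N hN] : 0 < e / 2 by rewrite divr_gt0.
exists N => n /hN h; have [r [-> _ hr]] := hardy_innerE (l - u n).
rewrite ltcR; apply: (@le_lt_trans _ _ (e / 2)); last by lra.
by apply: hr => K; rewrite taylorB tl; exact: h.
Qed.

HB.instance Definition _ := Lmodule_isHilbert.Build R hardy
  hardy_innerDZl hardy_innerJ hardy_inner_gt0 hardy_complete.

Lemma hardy_normE (f : hardy) :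
  `|f| ^+ 2 = lim (series (fun k => `|taylor f k| ^+ 2 : R[i]) @ \oo).
Proof.
rewrite normr_inner; congr (lim (series _ @ \oo)).
by apply/funext => k; rewrite normr_inner.
Qed.

Definition multiplier (Theta : disc -> E -> E) :=
  forall f, in_hardy f -> in_hardy (fun z => Theta z (f z)).

(* A symbol is required to map H^2(E) to itself instead of being bounded and
   analytic; the symbols used below satisfy this by [affine_multiplier]. *)
Definition mulop Theta (h : multiplier Theta) (f : hardy) : hardy :=
  Hardy (asboolT (h f (asboolW (hardyP f)))).

Lemma affine_multiplier (A B : E -> E) :
  bounded_operator A -> bounded_operator B ->
  multiplier (fun z x => A x + val z *: B x).
Proof.
move=> /bounded_operatorP[Al [M M0 AM]] /bounded_operatorP[Bl [N N0 BN]].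
move=> f [eta eta2 feta].
have lin_sum (T : E -> E) M' : linear T -> 0 <= M' ->
    (forall x, rnorm (T x) <= M' * rnorm x) ->
    square_summable (T \o eta) /\ has_expansion (T \o f) (T \o eta).
  move=> Tl M'0 TM; split; first exact: (square_summable_le M'0 eta2 (fun k => TM (eta k))).
  have TB x y : T x - T y = T (x - y).
    by rewrite addrC -scaleN1r -Tl scaleN1r addrC.
  have T0 : T 0 = 0 by rewrite -[0 in LHS](subrr 0) -TB subrr.
  move=> z; apply/cvg_seqP => e e0.
  have M1 : 0 < M' + 1 by lra.
  have /cvg_seqP/(_ (e / (M' + 1))) := feta z.
  rewrite divr_gt0// => /(_ isT)[K hK]; exists K => n /hK.
  rewrite ltr_pdivlMr// => h.
  have -> : series (fun k => val z ^+ k *: (T \o eta) k) n =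
      T (series (fun k => val z ^+ k *: eta k) n).
    rewrite /series /=; elim: n {h} => [|n IH]; first by rewrite !big_geq.
    by rewrite !big_nat_recr//= IH addrC -Tl addrC.
  rewrite /= TB; apply: le_lt_trans (TM _) _.
  have := rnorm_ge0 (f z - series (fun k => val z ^+ k *: eta k) n); nra.
have [A2 Af] := lin_sum A M Al M0 AM; have [B2 Bf] := lin_sum B N Bl N0 BN.
pose xi k := if k is k'.+1 then B (eta k') else 0.
have xi2 : square_summable xi.
  have /square_summableP[K hK] := B2; apply/square_summableP; exists K.
  case=> [|n]; first by have := hK 0%N; rewrite !big_geq.
  rewrite big_nat_recl//= rnorm0 expr0n add0r; exact: hK.
exists (fun k => A (eta k) + xi k); first exact: (square_summableD A2 xi2).
have xif : has_expansion (fun z => val z *: B (f z)) xi.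
  move=> z; apply/cvg_seqP => e e0.
  have /cvg_seqP/(_ e e0)[K hK] := Bf z; exists K.+1 => -[//|n]; rewrite ltnS => Kn.
  rewrite /series /= big_nat_recl//= scaler0 add0r.
  have -> : \sum_(0 <= i < n) val z ^+ i.+1 *: B (eta i) =
     val z *: series (fun k => val z ^+ k *: (B \o eta) k) n.
    by rewrite /series /= scaler_sumr; apply: eq_bigr => k _; rewrite scalerA exprS.
  rewrite -scalerBr rnormZ; apply: le_lt_trans (hK _ Kn).
  by rewrite ler_piMl ?rnorm_ge0// ltW// disc_rnorm.
move=> z; have := @has_expansionDZ _ _ _ _ 1 Af xif z; rewrite scale1r.
by under eq_fun do rewrite scale1r.
Qed.

End HardySpace.

Record bcl_triple (R : realType) (E : hilbertType R) := BCLTriple {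
  bcl_U : E -> E ;
  bcl_P : orthoproj E ;
  bcl_unitary : unitary bcl_U
}.

Section BCLPair.
Variables (R : realType) (E : hilbertType R) (T : bcl_triple E).
Local Notation U := (bcl_U T).
Local Notation P := (bcl_P T).
Local Notation Q := (perp P).

Definition bcl_Phi (z : disc R) : E -> E :=
  (fun x => P x + val z *: Q x) \o adjoint U.

Definition bcl_Psi (z : disc R) : E -> E :=
  U \o (fun x => Q x + val z *: P x).

Fact bcl_Phi_multiplier : multiplier bcl_Phi.
Proof.
have [Ub _ _] := bcl_unitary T; have Ub' := bounded_adjoint Ub.
apply: (@affine_multiplier _ _ (P \o adjoint U) (Q \o adjoint U)).
  exact: (bounded_comp (orthoproj_bounded P) Ub').
exact: (bounded_comp (orthoproj_bounded Q) Ub').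
Qed.

Fact bcl_Psi_multiplier : multiplier bcl_Psi.
Proof.
have [Ub _ _] := bcl_unitary T; have [Ul _] := Ub.
have -> : bcl_Psi = fun z x => (U \o Q) x + val z *: (U \o P) x.
  apply/funext => z; apply/funext => x.
  have UDZ a b c : U (b + c *: a) = U b + c *: U a by rewrite addrC Ul addrC.
  exact: UDZ.
apply: affine_multiplier.
  exact: (bounded_comp Ub (orthoproj_bounded Q)).
exact: (bounded_comp Ub (orthoproj_bounded P)).
Qed.

Definition M_Phi : hardy E -> hardy E := mulop bcl_Phi_multiplier.
Definition M_Psi : hardy E -> hardy E := mulop bcl_Psi_multiplier.

Lemma M_PhiE f z : M_Phi f z = P (adjoint U (f z)) + val z *: Q (adjoint U (f z)).
Proof. by []. Qed.

Lemma M_PsiE f z : M_Psi f z = U (Q (f z) + val z *: P (f z)).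
Proof. by []. Qed.

End BCLPair.

(* Main.v *)
(* On Taylor coefficients, multiplication by A + zB sends (eta_k) to
   (A eta_k + B eta_(k-1)); when A and B have orthogonal ranges and
   A^*A + B^*B = 1 it is an isometry M, and M^* sends (eta_k) to
   (A^* eta_k + B^* eta_(k+1)).  On constant functions M^* acts as A^*; on a
   polynomial, the top coefficient is transformed by A^* alone, so that induction
   on the degree and density of polynomials show that M is pure if and only if
   A^*^m -> 0 strongly.  For Phi this A^* is UP, for Psi it is P^perp U^*;
   comparing powers of ST with powers of TS identifies these conditions with
   purity of the compressions. *)
From mathcomp Require Import all_boot all_order all_algebra reals.
From mathcomp Require Import boolp classical_sets.
From mathcomp Require Import topology normedtype sequences.
From mathcomp Require Import complex.
From mathcomp Require Import ring lra.
Require Import Defs.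
Set Implicit Arguments.
Unset Strict Implicit.
Unset Printing Implicit Defensive.
Import Order.TTheory GRing.Theory Num.Theory.
Import numFieldNormedType.Exports.
Local Open Scope classical_set_scope.
Local Open Scope complex_scope.
Local Open Scope ring_scope.

(** * Algebra of linear maps and of iterated compositions *)

Section LinearMaps.
Variables (K : pzRingType) (V W : lmodType K) (T : V -> W).
Hypothesis Tl : linear T.

Lemma linear_mapD x y : T (x + y) = T x + T y.
Proof. by have := Tl 1 x y; rewrite !scale1r. Qed.

Lemma linear_mapB x y : T (x - y) = T x - T y.
Proof. by rewrite addrC -scaleN1r Tl scaleN1r addrC. Qed.

Lemma linear_map0 : T 0 = 0.
Proof. by rewrite -(subrr 0) linear_mapB subrr. Qed.

Lemma linear_map_sum n (a : nat -> K) (u : nat -> V) :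
  T (\sum_(0 <= k < n) a k *: u k) = \sum_(0 <= k < n) a k *: T (u k).
Proof.
elim: n => [|n IH]; first by rewrite !big_geq// linear_map0.
by rewrite !big_nat_recr//= addrC Tl IH addrC.
Qed.

End LinearMaps.

Lemma linear_map_iter (K : pzRingType) (V : lmodType K) (T : V -> V) m :
  linear T -> linear (iter m T).
Proof. by move=> Tl; elim: m => [|m IH] a x y //=; rewrite IH Tl. Qed.

Lemma iter_comp_swap (X Y : Type) (S : X -> Y) (T : Y -> X) m x :
  iter m (S \o T) (S x) = S (iter m (T \o S) x).
Proof. by elim: m => //= m ->. Qed.

(** * Bounded operators, contractions and their adjoints *)

Lemma contractionP (R : realType) (E F : hilbertType R) (T : E -> F) :
  contraction T <-> linear T /\ forall x, rnorm (T x) <= rnorm x.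
Proof.
by split=> -[Tl T1]; split => // x; move: (T1 x); rewrite !rnormE lecR.
Qed.

Section BoundedOperators.
Variables (R : realType) (E F : hilbertType R) (T : E -> F).

Lemma bounded_operator_cvg (u : nat -> E) l :
  bounded_operator T -> u @ \oo --> l -> (T \o u) @ \oo --> T l.
Proof.
move=> /bounded_operatorP[Tl [M M0 TM]] /cvg_seqP ul; apply/cvg_seqP => e e0.
have M1 : 0 < M + 1 by lra.
have /ul[N hN] : 0 < e / (M + 1) by rewrite divr_gt0.
exists N => n /hN; rewrite ltr_pdivlMr// => h.
rewrite /= -linear_mapB//; apply: le_lt_trans (TM _) _.
by have := rnorm_ge0 (l - u n); nra.
Qed.

Lemma contraction_bounded : contraction T -> bounded_operator T.
Proof. by move=> [Tl T1]; split => //; exists 1 => x; rewrite mul1r. Qed.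

Lemma isometry_contraction : isometry_operator T -> contraction T.
Proof. by move=> [Tl T1]; split => // x; rewrite T1. Qed.

Lemma adjoint_adjoint : bounded_operator T -> adjoint (adjoint T) = T.
Proof.
move=> /adjointP TP; apply: adjoint_eq => x y.
by rewrite innerC -TP -innerC.
Qed.

Lemma contraction_adjoint : contraction T -> contraction (adjoint T).
Proof.
move=> Tc; have Tb := contraction_bounded Tc.
have /contractionP[_ T1] := Tc.
apply/contractionP; split=> [|y]; first by have [] := bounded_adjoint Tb.
have [y0|y0] := eqVneq (rnorm (adjoint T y)) 0.
  by rewrite y0 rnorm_ge0.
have {}y0 : 0 < rnorm (adjoint T y) by rewrite lt_def y0 rnorm_ge0.
(* With w = [adjoint T y], the square |w|^2 is the inner product of [T w] and [y]; Cauchy-Schwarz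
   and |T w| <= |w| then allow division by |w| > 0. *)
have : rnorm (adjoint T y) ^+ 2 <= rnorm (T (adjoint T y)) * rnorm y.
  apply: le_trans (inner_norm_le _ _).
  by rewrite (adjointP Tb) inner_rnorm rnormC ger0_norm// sqr_ge0.
have := T1 (adjoint T y); have := rnorm_ge0 y; nra.
Qed.

End BoundedOperators.

Lemma contraction_comp (R : realType) (E F G : hilbertType R)
    (S : F -> G) (T : E -> F) :
  contraction S -> contraction T -> contraction (S \o T).
Proof.
move=> [Sl S1] [Tl T1]; split=> [a x y|x] /=; first by rewrite Tl Sl.
exact: le_trans (S1 _) (T1 _).
Qed.

Lemma adjoint_comp (R : realType) (E F G : hilbertType R)
    (S : F -> G) (T : E -> F) :
  bounded_operator S -> bounded_operator T ->
  adjoint (S \o T) = adjoint T \o adjoint S.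
Proof.
by move=> /adjointP SP /adjointP TP; apply: adjoint_eq => x y; rewrite SP TP.
Qed.

(** * Strong convergence to 0 of the powers of a contraction *)

Section Stability.
Variables (R : realType) (E : hilbertType R).
Implicit Types (T S : E -> E) (h : E).

(* For a contraction, the norms along an orbit decrease, so a single small
   iterate is the same as convergence to 0. *)
Definition stable T h := forall e : R, 0 < e -> exists m, rnorm (iter m T h) < e.

Lemma rnorm_iter_le T m h : contraction T -> rnorm (iter m T h) <= rnorm h.
Proof.
move=> /contractionP[_ T1]; elim: m => //= m; exact: le_trans (T1 _).
Qed.

Lemma stableP T h : contraction T ->
  stable T h <-> (fun m => `|iter m T h|) @ \oo --> (0 : R[i]).
Proof.
move=> Tc; have nE m : rnorm (0 - `|iter m T h|) = rnorm (iter m T h).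
  by rewrite rnormBC subr0 /rnorm normr_id.
split=> [Th|/cvg_seqP Th].
  apply/cvg_seqP => e /Th[N hN]; exists N => n Nn; rewrite nE.
  by rewrite -(subnK Nn) iterD; exact: le_lt_trans (rnorm_iter_le _ _ Tc) hN.
by move=> e /Th[N hN]; exists N; rewrite -nE; exact: hN.
Qed.

Lemma stable_iter T m h : stable T (iter m T h) -> stable T h.
Proof. by move=> Th e /Th[n]; rewrite -iterD => hn; exists (n + m)%N. Qed.

(** The stable vectors form a closed set, since all powers of a contraction are bounded by 1. This
    reduces purity to a dense set of vectors. *)
Lemma stable_approx T h : contraction T ->
  (forall e : R, 0 < e -> exists2 g, stable T g & rnorm (h - g) < e) -> stable T h.
Proof.
move=> Tc hg e e0; have e20 : 0 < e / 2 by rewrite divr_gt0.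
have [g Tg gh] := hg _ e20; have [m hm] := Tg _ e20; exists m.
rewrite -(subrK g h) linear_mapD; last by apply: linear_map_iter; case: Tc.
apply: le_lt_trans (rnormD _ _) _.
have := rnorm_iter_le m (h - g) Tc; lra.
Qed.

(** (ST)^(m+1) h = S (TS)^m (T h): one extra iterate lets smallness pass from TS to ST through the
    contraction [S]. *)
Lemma stable_comp_swap T S : contraction S ->
  (forall h, stable (T \o S) h) -> forall h, stable (S \o T) h.
Proof.
move=> /contractionP[_ S1] TS h; apply: (@stable_iter _ 1) => e e0.
have [m hm] := TS (T h) _ e0; exists m.
by rewrite iter_comp_swap; exact: le_lt_trans (S1 _) hm.
Qed.

End Stability.

(** * Orthogonal projections and compressions to their ranges *)

Section Projections.
Variables (R : realType) (E : hilbertType R) (P : orthoproj E).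

Lemma orthoproj_inner x y : inner (P x) y = inner x (P y).
Proof. by rewrite (adjointP (orthoproj_bounded P)) orthoproj_adjoint. Qed.

(** The ranges of [P] and [perp P] are orthogonal because [P (perp P y) = 0]. Independent [x] and
    [y] are allowed, because neighbouring Taylor coefficients will be inserted. *)
Lemma orthoproj_pythagoras x y :
  rnorm (P x + perp P y) ^+ 2 = rnorm (P x) ^+ 2 + rnorm (perp P y) ^+ 2.
Proof.
have o : inner (P x) (perp P y) = 0.
  rewrite perpE orthoproj_inner linear_mapB ?orthoproj_idem ?subrr.
    by rewrite innerC inner0l rmorph0.
  by case: (orthoproj_bounded P).
move: (perp P y) o => q o.
apply: complexI; rewrite !rmorphD /= -!inner_rnorm !(innerDl, innerDr) o.
by rewrite [inner q _]innerC o rmorph0; ring.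
Qed.

Lemma orthoproj_rnorm x : rnorm x ^+ 2 = rnorm (P x) ^+ 2 + rnorm (perp P x) ^+ 2.
Proof. by rewrite -orthoproj_pythagoras perpE addrC subrK. Qed.

Lemma orthoproj_contraction : contraction P.
Proof.
have [Pl _] := orthoproj_bounded P; apply/contractionP; split => // x.
rewrite -(@ler_pXn2r _ 2) ?nnegrE ?rnorm_ge0// (orthoproj_rnorm x).
by rewrite lerDl sqr_ge0.
Qed.

Lemma ran_rnorm (x : ran P) : rnorm x = rnorm (x : E).
Proof.
apply/eqP; rewrite -(@eqrXn2 _ 2) ?rnorm_ge0//; apply/eqP/complexI.
by rewrite -!inner_rnorm.
Qed.

Lemma ran_proj (x : ran P) : P x = x.
Proof. by apply/in_ranP; exact: ran_valP. Qed.

Lemma compression_contraction T : contraction T -> contraction (compression P T).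
Proof.
move=> Tc; have PTc := contraction_comp orthoproj_contraction Tc.
have /contractionP[PTl PT1] := PTc; apply/contractionP; split=> [a x y|x].
  have [Pl _] := orthoproj_bounded P.
  by apply: val_inj; rewrite /= Pl !ran_proj; exact: PTl.
by rewrite !ran_rnorm /= ran_proj; exact: PT1.
Qed.

Lemma adjoint_compression T : bounded_operator T ->
  adjoint (compression P T) = compression P (adjoint T).
Proof.
move=> Tb; apply: adjoint_eq => x y.
by rewrite !ran_innerE /= orthoproj_inner (adjointP Tb) orthoproj_inner.
Qed.

Lemma iter_compression T m x :
  iter m (compression P T) x = iter m (P \o T) x :> E.
Proof. by elim: m => //= m IH; rewrite ran_proj IH. Qed.

(** The adjoint of the compression of [T] is the compression of [adjoint T], whose iterates on ran P
    are those of [P \o adjoint T]. A vector outside ran P enters it after one application, which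
    does not affect stability. *)
Lemma pure_compressionP T : contraction T ->
  pure_contraction (compression P T) <-> forall x, stable (P \o adjoint T) x.
Proof.
move=> Tc; have Cc := compression_contraction Tc.
have C'c := contraction_adjoint Cc.
have C'E := adjoint_compression (contraction_bounded Tc).
have C'P (x : ran P) : stable (adjoint (compression P T)) x <->
    stable (P \o adjoint T) (x : E).
  by split=> h e /h[m hm]; exists m; move: hm; rewrite C'E ran_rnorm iter_compression.
split=> [[_ h] x|h].
  apply: (@stable_iter _ _ _ 1); apply/(C'P (Ran (proj_in_ran P (adjoint T x)))).
  exact/stableP.
by split => // x; apply/stableP => //; exact/C'P.
Qed.

End Projections.

(** * Norm preservation by a unitary and its adjoint *)

Section Unitary.
Variables (R : realType) (E : hilbertType R) (U : E -> E).
Hypothesis UU : unitary U.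

Lemma unitary_rnorm x : rnorm (U x) = rnorm x.
Proof.
have [Ub U1 _] := UU; apply/eqP; rewrite -(@eqrXn2 _ 2) ?rnorm_ge0//.
apply/eqP/complexI; rewrite -!inner_rnorm (adjointP Ub).
by rewrite -[adjoint U _]/((adjoint U \o U) x) U1.
Qed.

Lemma unitary_adjoint_rnorm x : rnorm (adjoint U x) = rnorm x.
Proof.
by have [_ _ U1] := UU; rewrite -unitary_rnorm -[U _]/((U \o adjoint U) x) U1.
Qed.

Lemma unitary_contraction : contraction U.
Proof.
by have [[Ul _] _ _] := UU; apply/contractionP; split=> // x; rewrite unitary_rnorm.
Qed.

End Unitary.

(** * Taylor coefficients, monomials and polynomials in the Hardy space *)

Section HardyCoefficients.
Variables (R : realType) (E : hilbertType R).
Implicit Types (f g : hardy E) (eta : nat -> E).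

Lemma taylor_inj : injective (@taylor R E).
Proof.
move=> f g fg; apply/eqP; rewrite -subr_eq0; apply/negPn/negP => /hardy_inner_gt0.
have [r [-> _ h]] := hardy_innerE (f - g); rewrite ltcR ltNge h// => n.
by rewrite taylorB fg big1// => k _; rewrite subrr rnorm0 expr0n.
Qed.

Lemma taylor_surj eta : square_summable eta -> exists f : hardy E, taylor f = eta.
Proof.
move=> h; exists (Hardy (asboolT (in_hardy_series h))).
by apply: taylor_eq => // z; exact: square_summable_cvg.
Qed.

(** The squared norm is the supremum of the partial sums; in this form norm estimates reduce to
    finite sums. *)
Lemma hardy_rnormP f :
  (forall n, \sum_(0 <= k < n) rnorm (taylor f k) ^+ 2 <= rnorm f ^+ 2) /\
  (forall B, (forall n, \sum_(0 <= k < n) rnorm (taylor f k) ^+ 2 <= B) ->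
     rnorm f ^+ 2 <= B).
Proof.
have [r [fr h1 h2]] := hardy_innerE f.
suff -> : rnorm f ^+ 2 = r by [].
by apply: complexI; rewrite -inner_rnorm -fr.
Qed.

Lemma rnorm_taylor f k : rnorm (taylor f k) <= rnorm f.
Proof.
rewrite -(@ler_pXn2r _ 2) ?nnegrE ?rnorm_ge0//.
apply: le_trans ((hardy_rnormP f).1 k.+1); rewrite big_nat_recr//= lerDr.
by apply: sumr_ge0 => i _; exact: sqr_ge0.
Qed.

Lemma truncationP f n :
  exists g, taylor g = fun k => if (k < n)%N then taylor f k else 0.
Proof.
apply: taylor_surj; apply: (@square_summable_le _ _ _ (taylor f) 1) => //.
  by have [] := taylorP f.
by move=> k; rewrite mul1r; case: ifP => // _; rewrite rnorm0 rnorm_ge0.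
Qed.

Lemma square_summable_monomial n (x : E) :
  square_summable (fun k => if k == n then x else 0).
Proof.
apply/square_summableP; exists (rnorm x ^+ 2) => m.
have x0 := sqr_ge0 (rnorm x).
elim: m => [|m IH]; first by rewrite big_geq.
rewrite big_nat_recr//=; case: eqP => [->|_]; last by rewrite rnorm0 expr0n addr0.
rewrite big_nat_cond big1 ?add0r// => k; rewrite andbT => /andP[_ kn].
by rewrite ltn_eqF// rnorm0 expr0n.
Qed.

Definition monomial n (x : E) : hardy E :=
  Hardy (asboolT (in_hardy_series (@square_summable_monomial n x))).

Lemma taylor_monomial n x :
  taylor (monomial n x) = fun k => if k == n then x else 0.
Proof.
have h := @square_summable_monomial n x.
by apply: taylor_eq => // z; exact: square_summable_cvg.
Qed.

(** Only the term of index [n] survives. Pairing with monomials thus reads off coefficients, which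
    gives those of an adjoint. *)
Lemma inner_monomial n x g : inner (monomial n x) g = inner x (taylor g n).
Proof.
apply: cvg_lim => //; apply/cvg_seqP => e e0; exists n.+1 => m nm.
rewrite taylor_monomial /series /= big_mkord (bigD1 (Ordinal nm))//= eqxx.
rewrite big1 ?addr0 ?subrr ?rnorm0// => k.
by rewrite -val_eqE => /negPf /= ->; rewrite inner0l.
Qed.

Lemma rnorm_monomial n x : rnorm (monomial n x) = rnorm x.
Proof.
apply/eqP; rewrite -(@eqrXn2 _ 2) ?rnorm_ge0//; apply/eqP/complexI.
by rewrite -!inner_rnorm inner_monomial taylor_monomial eqxx.
Qed.

Lemma polynomial_dense f (e : R) : 0 < e -> exists n g,
  (forall k, (n <= k)%N -> taylor g k = 0) /\ rnorm (f - g) < e.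
Proof.
move=> e0; have [fle lef] := hardy_rnormP f.
have e20 : 0 < e / 2 by rewrite divr_gt0.
(* Some partial sum comes within (e/2)^2 of the supremum; the rest bounds the error of truncation at
   [n]. *)
have [n hn] : exists n,
    rnorm f ^+ 2 - (e / 2) ^+ 2 < \sum_(0 <= k < n) rnorm (taylor f k) ^+ 2.
  apply: contrapT => /forallNP h.
  have : rnorm f ^+ 2 <= rnorm f ^+ 2 - (e / 2) ^+ 2.
    by apply: lef => n; rewrite leNgt; exact/negP/h.
  by have := exprn_gt0 2 e20; lra.
have [g gE] := truncationP f n; exists n, g; split.
  by move=> k nk; rewrite gE ltnNge nk.
apply: (@le_lt_trans _ _ (e / 2)); last by lra.
rewrite -(@ler_pXn2r _ 2) ?nnegrE ?rnorm_ge0 ?(ltW e20)//.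
apply: (hardy_rnormP (f - g)).2 => N.
(* Summing up to [maxn n N] makes the split at [n] possible: [f - g] vanishes below it and agrees
   with [f] above it. *)
apply: (@le_trans _ _ (\sum_(0 <= k < maxn n N) rnorm (taylor (f - g) k) ^+ 2)).
  rewrite (big_cat_nat (leq0n N) (leq_maxr n N)) /= lerDl sumr_ge0// => k _.
  exact: sqr_ge0.
have := fle (maxn n N); rewrite !(big_cat_nat (leq0n n) (leq_maxl n N)) /=.
have -> : \sum_(0 <= k < n) rnorm (taylor (f - g) k) ^+ 2 = 0.
  rewrite big_nat_cond big1// => k /andP[/andP[_ kn] _].
  by rewrite taylorB gE kn subrr rnorm0 expr0n.
have -> : \sum_(n <= k < maxn n N) rnorm (taylor (f - g) k) ^+ 2 =
    \sum_(n <= k < maxn n N) rnorm (taylor f k) ^+ 2.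
  by apply: eq_big_nat => k /andP[nk _]; rewrite taylorB gE ltnNge nk subr0.
by move: hn; lra.
Qed.

End HardyCoefficients.

(** * Multiplication by an affine symbol A + zB *)

Section AffineSymbol.
Variables (R : realType) (E : hilbertType R) (A B : E -> E).
Variable M : hardy E -> hardy E.
Hypotheses (Ab : bounded_operator A) (Bb : bounded_operator B).
Hypothesis ME : forall f z, M f z = A (f z) + val z *: B (f z).
Implicit Types f g : hardy E.

Definition affine_coef (eta : nat -> E) k :=
  A (eta k) + if k is k'.+1 then B (eta k') else 0.

Lemma affine_linear : linear M.
Proof.
have [[Al _] [Bl _]] := (Ab, Bb).
move=> a f g; apply: val_inj; apply/funext => z.
rewrite -[RHS]/(a *: M f z + M g z) -[LHS]/(M _ z) !ME.
rewrite -[LHS]/(A (a *: f z + g z) + val z *: B (a *: f z + g z)).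
by rewrite Al Bl !scalerDr !scalerA [val z * a]mulrC addrACA.
Qed.

Lemma taylor_affine f : taylor (M f) = affine_coef (taylor f).
Proof.
have [f2 fE] := taylorP f; have [Al _] := Ab; have [Bl _] := Bb.
apply: taylor_eq.
  have [/bounded_operatorP[_ [N N0 AN]] /bounded_operatorP[_ [N' N'0 BN]]] := (Ab, Bb).
  apply: square_summableD; first exact: (square_summable_le N0 f2 (fun k => AN _)).
  have /square_summableP[K hK] := square_summable_le N'0 f2 (fun k => BN (taylor f k)).
  apply/square_summableP; exists K => -[|n]; first by have := hK 0%N; rewrite !big_geq.
  by rewrite big_nat_recl//= rnorm0 expr0n add0r.
(* The factor z costs one degree: n+1 terms for [A] match n terms for [B]. *)
move=> z; rewrite ME -cvg_shiftS /=.
have Afz := bounded_operator_cvg Ab (fE z).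
have Bfz := bounded_operator_cvg Bb (fE z).
rewrite (_ : (fun n => _) = fun n =>
    A (series (fun k => val z ^+ k *: taylor f k) n.+1) +
    val z *: B (series (fun k => val z ^+ k *: taylor f k) n)).
  apply: cvgD; last exact: cvgZl_tmp.
  by rewrite (cvg_shiftS (A \o _)).
apply/funext => n; rewrite /series /= (linear_map_sum Al) (linear_map_sum Bl) scaler_sumr.
rewrite big_nat_recl// [in RHS]big_nat_recl//= /affine_coef addr0 -addrA -big_split.
by congr (_ + _); apply: eq_bigr => k _ /=; rewrite scalerDr scalerA exprS.
Qed.

Hypothesis AB_orthogonal : forall x y,
  rnorm (A x + B y) ^+ 2 = rnorm (A x) ^+ 2 + rnorm (B y) ^+ 2.
Hypothesis AB_norm : forall x, rnorm x ^+ 2 = rnorm (A x) ^+ 2 + rnorm (B x) ^+ 2.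

Lemma affine_isometry : isometry_operator M.
Proof.
split; first exact: affine_linear.
(* By orthogonality the [B] part of coefficient k+1 joins the [A] part of coefficient k into the
   full square of coefficient k; only the last [A] part is left over. *)
have sumE f n : \sum_(0 <= k < n.+1) rnorm (taylor (M f) k) ^+ 2 =
    \sum_(0 <= k < n) rnorm (taylor f k) ^+ 2 + rnorm (A (taylor f n)) ^+ 2.
  elim: n => [|n IH].
    by rewrite big_nat_recr//= !big_geq// taylor_affine /affine_coef addr0.
  rewrite big_nat_recr//= IH [in RHS]big_nat_recr//= taylor_affine /affine_coef.
  by rewrite AB_orthogonal (AB_norm (taylor f n)); ring.
move=> f; rewrite !rnormE; congr (_%:C); apply/eqP.
have [f1 f2] := hardy_rnormP f; have [g1 g2] := hardy_rnormP (M f).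
rewrite -(@eqrXn2 _ 2) ?rnorm_ge0// eq_le; apply/andP; split.
  apply: g2 => -[|n]; first by rewrite big_geq// sqr_ge0.
  rewrite sumE; apply: le_trans (f1 n.+1); rewrite big_nat_recr//= lerD2l.
  by rewrite [leRHS]AB_norm lerDl sqr_ge0.
by apply: f2 => n; apply: le_trans (g1 n.+1); rewrite sumE lerDl sqr_ge0.
Qed.

Let Mc : contraction M := isometry_contraction affine_isometry.
Let M'c : contraction (adjoint M) := contraction_adjoint Mc.

Lemma affine_monomial n x :
  M (monomial n x) = monomial n (A x) + monomial n.+1 (B x).
Proof.
have [[Al _] [Bl _]] := (Ab, Bb).
apply: taylor_inj; rewrite -[monomial n (A x)]scale1r taylorDZ taylor_affine.
rewrite !taylor_monomial /affine_coef; apply/funext => k; rewrite scale1r.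
congr (_ + _); first by case: ifP => // _; rewrite linear_map0.
by case: k => // k; rewrite eqSS; case: ifP => // _; rewrite linear_map0.
Qed.

Lemma taylor_affine_adjoint f n :
  taylor (adjoint M f) n = adjoint A (taylor f n) + adjoint B (taylor f n.+1).
Proof.
apply: inner_inj => x.
rewrite -inner_monomial -(adjointP (contraction_bounded Mc)) affine_monomial.
by rewrite innerDl innerDr !inner_monomial -(adjointP Ab) -(adjointP Bb).
Qed.

(** [adjoint M] never raises the degree, and the only other contribution to coefficient [n] comes
    from coefficient n+1, which is 0. *)
Lemma iter_affine_adjoint_top f n m :
  (forall k, (n < k)%N -> taylor f k = 0) ->
  taylor (iter m (adjoint M) f) n = iter m (adjoint A) (taylor f n) /\
  (forall k, (n < k)%N -> taylor (iter m (adjoint M) f) k = 0).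
Proof.
have [A'l _] := bounded_adjoint Ab; have [B'l _] := bounded_adjoint Bb.
move=> fn; elim: m => //= m [IH0 IH]; split=> [|k nk].
  by rewrite taylor_affine_adjoint IH0 IH// linear_map0 ?addr0.
rewrite taylor_affine_adjoint (IH k)// (IH k.+1); last exact: ltnW.
by rewrite (linear_map0 A'l) (linear_map0 B'l) addr0.
Qed.

Lemma stable_polynomial n f :
  (forall x, stable (adjoint A) x) ->
  (forall k, (n <= k)%N -> taylor f k = 0) -> stable (adjoint M) f.
Proof.
move=> A's; elim: n f => [|n IH] f fn.
  suff -> : f = 0 by move=> e e0; exists 0%N; rewrite /= rnorm0.
  apply: taylor_inj; rewrite -[0 in RHS](subrr f) taylorB; apply/funext => k.
  by rewrite subrr fn.
move=> e e0; have e20 : 0 < e / 2 by rewrite divr_gt0.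
(* After [m] steps the top term has norm below e/2 and stays so under the contraction [adjoint M];
   what remains has lower degree and falls to the induction hypothesis. *)
have [m hm] := A's (taylor f n) _ e20.
have [top high] := @iter_affine_adjoint_top f n m fn.
pose a := monomial n (iter m (adjoint A) (taylor f n)).
have [k hk] : exists k, rnorm (iter k (adjoint M) (iter m (adjoint M) f - a)) < e / 2.
  apply: IH => // k; rewrite leq_eqVlt taylorB taylor_monomial => /predU1P[<-|nk].
    by rewrite eqxx top subrr.
  by rewrite high// gtn_eqF// subr0.
exists (k + m)%N; rewrite iterD -(subrK a (iter m _ f)).
rewrite linear_mapD; last by apply: linear_map_iter; case: M'c.
apply: le_lt_trans (rnormD _ _) _.
by have := rnorm_iter_le k a M'c; rewrite rnorm_monomial; lra.
Qed.

Lemma affine_pure_isometryP :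
  pure_isometry M <-> forall x, stable (adjoint A) x.
Proof.
split=> [[_ [_ h]] x e e0|h].
  (* Test purity on the constant function x: coefficient 0 of its m-th iterate is the m-th iterate
     of x under [adjoint A], and a coefficient is bounded by the norm. *)
  have /stableP -/(_ M'c)/(_ e e0)[m hm] := h (monomial 0 x).
  exists m; apply: le_lt_trans hm; apply: le_trans (rnorm_taylor _ 0).
  have [|-> _] := @iter_affine_adjoint_top (monomial 0 x) 0 m.
    by move=> k k0; rewrite taylor_monomial gtn_eqF.
  by rewrite taylor_monomial eqxx.
split; first exact: affine_isometry.
split=> // f; apply/stableP => //; apply: stable_approx => // e e0.
have [n [g [gn fg]]] := polynomial_dense f e0.
by exists g => //; exact: stable_polynomial gn.
Qed.

End AffineSymbol.

Theorem theorem3p4 (R : realType) (E : hilbertType R) (T : bcl_triple E) :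
  (pure_isometry (M_Phi T) <->
     pure_contraction (compression (bcl_P T) (adjoint (bcl_U T)))) /\
  (pure_isometry (M_Psi T) <->
     pure_contraction (compression (perp (bcl_P T)) (bcl_U T))).
Proof.
have UU := bcl_unitary T; have [Ub _ _] := UU; have U'b := bounded_adjoint Ub.
have Uc := unitary_contraction UU; have U'c := contraction_adjoint Uc.
set P := bcl_P T; set U := bcl_U T; set Q := perp P.
have Pb := orthoproj_bounded P; have Qb := orthoproj_bounded Q.
have Pc := orthoproj_contraction P.
split.
  apply: iff_trans (iff_sym (pure_compressionP P U'c)).
  rewrite adjoint_adjoint//.
  apply: iff_trans (@affine_pure_isometryP _ _ (P \o adjoint U) (Q \o adjoint U)
      _ _ _ _ _ _) _.
  - exact: bounded_comp.
  - exact: bounded_comp.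
  - exact: M_PhiE.
  - by move=> x y; exact: orthoproj_pythagoras.
  - by move=> x; rewrite /= -orthoproj_rnorm unitary_adjoint_rnorm.
  rewrite adjoint_comp// adjoint_adjoint// orthoproj_adjoint.
  (* The symbol yields [U \o P], the compression [P \o U]; the factors are exchanged in either
     direction. *)
  by split; exact: stable_comp_swap.
apply: iff_trans (iff_sym (pure_compressionP Q Uc)).
apply: iff_trans (@affine_pure_isometryP _ _ (U \o Q) (U \o P) _ _ _ _ _ _) _.
- exact: bounded_comp.
- exact: bounded_comp.
- by move=> f z; rewrite M_PsiE addrC; case: Ub => Ul _; rewrite Ul addrC.
- move=> x y; have [Ul _] := Ub.
  (* [U] preserves norms, so the orthogonality of Qx and Py carries over to their images. *)
  rewrite /comp -(linear_mapD Ul) !(unitary_rnorm UU) addrC orthoproj_pythagoras.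
  exact: addrC.
- by move=> x; rewrite /comp !(unitary_rnorm UU) addrC -orthoproj_rnorm.
(* Here the adjoint of [U \o Q] is already the operator [Q \o adjoint U] that governs the
   compression. *)
by rewrite adjoint_comp// orthoproj_adjoint.
Qed.
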